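(* There is an absolute constant $c>0$ such that for all positive integers $n$ and $t$ the following holds: every deterministic finite automaton that separates $\mathrm{EvenCycles}_{n,2}$ from $\mathrm{OddCycles}_{n,2}$ in time $t$ has at least $\exp\left(c\, n^5/t^4\right)$ states. (In the paper's notation: the number of states is $\exp\left(\Omega(n^5/t^4)\right)$.)
   Context: Let $\Sigma=[n]\times[d]$ where $[m]=\{1,\dots,m\}$. A deterministic finite automaton over $\Sigma$ consists of a finite set $Q$ of states, an initial state $q_{start}\in Q$ and a transition function $\delta\colon Q\times\Sigma\to Q$, extended to words in the usual way. For disjoint $A,B\subseteq\Sigma^{\mathbb N}$, the automaton separates $A$ from $B$ in time $t$ if there is a state $q_{accept}$ such that for every infinite word $w=w_1w_2\ldots\in\Sigma^{\mathbb N}$: if $w\in A$ then $\delta(q_{start},w_1\ldots w_i)=q_{accept}$ for all $i\ge t$; if $w\in B$ then $\delta(q_{start},w_1\ldots w_i)\neq q_{accept}$ for all $i\ge 1$. A game graph with $n$ nodes and $d$ priorities is a pair $G=\langle E,\pi\rangle$ where $E\subseteq[n]^2$ is a set of directed edges (loops allowed, no parallel edges) such that every node $u\in[n]$ has at least one outgoing edge, and $\pi\colon E\to[d]$ assigns priorities. $G$ is even (resp. odd) if for every $k\ge1$ and every $v_1,\dots,v_k$ with $(v_1,v_2),\dots,(v_{k-1},v_k),(v_k,v_1)\in E$, the maximum of $\pi$ over these $k$ edges is even (resp. odd). $\mathrm{EvenCycles}_{n,d}$ (resp. $\mathrm{OddCycles}_{n,d}$) is the set of infinite words $(v_1,l_1)(v_2,l_2)\ldots\in\Sigma^{\mathbb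 N}$ for which there exists an even (resp. odd) game graph $G=\langle E,\pi\rangle$ with at most $n$ nodes and $d$ priorities such that $(v_i,v_{i+1})\in E$ and $\pi((v_i,v_{i+1}))=l_i$ for all $i\ge1$. *)

(* Defs.v *)
From Stdlib Require Import Reals.
From mathcomp Require Import all_boot.
Set Implicit Arguments. Unset Strict Implicit. Unset Printing Implicit Defensive.

(* Alphabet Sigma = [n] x [d], encoded 0-based: the letter (v, l) : 'I_n * 'I_d
   stands for the node v+1 and the priority l+1. *)
Definition Sigma (n d : nat) : Type := ('I_n * 'I_d)%type.

(* A game graph on the node set {0,..,m-1} (i.e. [m] shifted by one):
   E is the edge relation, pi the priority (1-based, only relevant on edges). *)
Definition is_game_graph (d m : nat) (E : nat -> nat -> bool) (pi : nat -> nat -> nat) : Prop :=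
  (forall u v, E u v -> u < m /\ v < m) /\
  (forall u, u < m -> exists v, E u v) /\
  (forall u v, E u v -> 1 <= pi u v <= d).

Definition cycle_max (pi : nat -> nat -> nat) (s : seq nat) : nat :=
  \max_(i < size s) pi (nth 0 s i) (nth 0 s (i.+1 %% size s)).

Definition graph_parity (even : bool) (E : nat -> nat -> bool) (pi : nat -> nat -> nat) : Prop :=
  forall s : seq nat, 0 < size s -> cycle E s -> odd (cycle_max pi s) = ~~ even.

(* Words are infinite sequences w : nat -> Sigma, w 0 being the first letter w_1. *)
Definition cycles_lang (even : bool) (n d : nat) (w : nat -> Sigma n d) : Prop :=
  exists (m : nat) (E : nat -> nat -> bool) (pi : nat -> nat -> nat),
    m <= n /\ is_game_graph d m E pi /\ graph_parity even E pi /\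
    forall i : nat,
      E (nat_of_ord (w i).1) (nat_of_ord (w i.+1).1) /\
      pi (nat_of_ord (w i).1) (nat_of_ord (w i.+1).1) = (nat_of_ord (w i).2).+1.

Arguments cycles_lang : clear implicits.
Definition EvenCycles (n d : nat) := cycles_lang true n d.
Definition OddCycles (n d : nat) := cycles_lang false n d.

Fixpoint run (Q A : Type) (q0 : Q) (delta : Q -> A -> Q) (w : nat -> A) (i : nat) : Q :=
  match i with
  | 0 => q0
  | i'.+1 => delta (run q0 delta w i') (w i')
  end.

Definition separates (Q A : Type) (q0 : Q) (delta : Q -> A -> Q)
    (LA LB : (nat -> A) -> Prop) (t : nat) : Prop :=
  exists qacc : Q, forall w : nat -> A,
    (LA w -> forall i, t <= i -> run q0 delta w i = qacc) /\
    (LB w -> forall i, 1 <= i -> run q0 delta w i <> qacc).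
Arguments EvenCycles : clear implicits.
Arguments OddCycles : clear implicits.

(* Main.v *)
(** Fix an automaton with few states.  An even word w and an odd word y are built
    row by row, reaching the same state after each of the [p] rows.  A row has [p]
    phases of [b] letters; all its letters have priority 1 except the last one.

    Each position l < b owns [p] slots, and each slot is occupied by a vertex.  The
    even word hides a shift a in (Z/p)^b: in phase j it visits the occupant of slot
    [a_l + j] for l = 0, 1, ..., so that it meets every slot once per row, always in
    the same order, and the graph it walks has no cycle of priority 1.  The shift is
    never fixed: at each row we keep the shifts leading to the most popular state.
    In a row, a further pigeonhole on the states between phases leaves a set of
    shifts of density at least |Q|^-2p with a common state trajectory.  Its
    translates by 0, ..., p-1 are dense in (Z/p)^b, so by concentration of measure
    a single z lies within Hamming distance [D] of all of them.  The odd word follows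
    the same trajectory, using in phase j a translate by j that is close to z, hence
    visits at most [b + p D] vertices in the row.  These vertices are then replaced
    by fresh ones in their slots, so that the odd word never meets them again.

    The vertices suffice when [p b + p (b + p D) <= n], while the words have length
    [p^2 b]; with p about 8 t / n, b about n / 4p and D about n / 2p^2, this leads to
    a contradiction whenever |Q| < exp (c n^5 / t^4). *)
Require Import Defs.
From Stdlib Require Import Reals Lra.
From mathcomp Require Import all_boot.
Set Implicit Arguments. Unset Strict Implicit. Unset Printing Implicit Defensive.
(* MathComp binds the key [R] to [ring_scope]. *)
Delimit Scope R_scope with Re.

(** * Numerical parameters *)

Lemma INR_addn m n : INR (m + n) = (INR m + INR n)%Re.
Proof. exact: plus_INR. Qed.

Lemma INR_muln m n : INR (m * n) = (INR m * INR n)%Re.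
Proof. exact: mult_INR. Qed.

Lemma INR_expn m n : INR (m ^ n) = (INR m ^ n)%Re.
Proof. by elim: n => // n IH; rewrite expnS INR_muln IH. Qed.

Lemma INR_leq m n : m <= n -> (INR m <= INR n)%Re.
Proof. by move=> /leP; apply: le_INR. Qed.

Lemma INR_ltn m n : (INR m < INR n)%Re -> m < n.
Proof. by move=> /INR_lt /ltP. Qed.

Lemma exp_pow x m : (exp x ^ m)%Re = exp (INR m * x).
Proof.
elim: m => [|m IH]; first by rewrite /= Rmult_0_l exp_0.
by rewrite S_INR /= IH -exp_plus; f_equal; ring.
Qed.

(** Here [x], [y], [a], [M] stand for n, t, the number of phases and |Q|. As [exp (/ 2) <= 2 <= M],
    the bound on [M] forces [x ^ 5 / y ^ 4 > 2 ^ 23], while [a * x <= 16 * y] makes this ratio at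
    most [2 ^ 16 * x / a ^ 4]. *)
Lemma large_ratio (x y a M : R) :
  (1 <= x -> x <= y -> 8 <= a -> a * x <= 16 * y -> 2 <= M ->
   M < exp (/ 2 ^ 24 * x ^ 5 / y ^ 4) ->
   128 * a ^ 4 <= x /\ M < exp (x / (256 * a ^ 4)))%Re.
Proof.
move=> x1 xy a8 axy M2 Mexp.
set X := (x ^ 5 / y ^ 4)%Re.
have expX : (M < exp (/ 2 ^ 24 * X))%Re by rewrite /X /Rdiv -Rmult_assoc.
have y4 : (0 < y ^ 4)%Re by apply: pow_lt; lra.
have a4 : (0 < a ^ 4)%Re by apply: pow_lt; lra.
have Xa : (X * a ^ 4 <= 2 ^ 16 * x)%Re.
  have H : ((a * x) ^ 4 <= (16 * y) ^ 4)%Re.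
    by apply: pow_incr; split=> //; apply: Rmult_le_pos; lra.
  have H' : (x * (a * x) ^ 4 <= x * (16 * y) ^ 4)%Re.
    by apply: Rmult_le_compat_l; lra.
  apply: (Rmult_le_reg_r (y ^ 4)%Re) => //.
  rewrite (_ : (X * a ^ 4 * y ^ 4)%Re = (x * (a * x) ^ 4)%Re).
    by rewrite (_ : (2 ^ 16 * x * y ^ 4)%Re = (x * (16 * y) ^ 4)%Re) //; ring.
  by rewrite /X; field; lra.
have Xbig : (2 ^ 23 < X)%Re.
  have half : (exp (/ 2) <= 2)%Re.
    have E : (exp (/ 2) * exp (/ 2) <= 3)%Re.
      by rewrite -exp_plus (_ : (/ 2 + / 2)%Re = 1%Re); [apply: exp_le_3 | field].
    by have := exp_pos (/ 2); nra.
  have : (exp (/ 2) < exp (/ 2 ^ 24 * X))%Re by lra.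
  by move/exp_lt_inv; lra.
clearbody X.
split; first by nra.
apply: Rlt_le_trans expX _.
suff [lt|eq] : (/ 2 ^ 24 * X <= x / (256 * a ^ 4))%Re.
- by left; apply: exp_increasing.
- by right; rewrite eq.
apply: (Rmult_le_reg_r (256 * a ^ 4)%Re); first lra.
rewrite (_ : (x / (256 * a ^ 4) * (256 * a ^ 4))%Re = x); last by field; lra.
by nra.
Qed.

Lemma pow_le_exp (u v z : R) m :
  (0 <= u -> 0 <= v -> u <= v * exp z -> u ^ m <= v ^ m * exp (INR m * z))%Re.
Proof. by move=> u0 v0 uv; rewrite -exp_pow -Rpow_mult_distr; apply: pow_incr. Qed.

(** The factors without [M] are compared with exponentials through [1 + z <= exp z]: the two bases
    with exponent [B] have ratio 1 + 1/(4a(a+1)), those with exponent [D] have ratio 1 - 1/(a+1). *)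
Lemma concentration_parameters (x M : R) (P B D : nat) :
  let a := INR P in
  (8 <= a -> 128 * a ^ 4 <= x -> 4 * a * INR B <= x -> x <= 4 * a ^ 2 * INR D ->
   0 < M -> M < exp (x / (256 * a ^ 4)) ->
   a * (M ^ P * M ^ P) * ((2 * a + 1) ^ 2) ^ B * a ^ D
     < (4 * a * (a + 1)) ^ B * (a + 1) ^ D)%Re.
Proof.
move=> a a8 xbig Bx Dx M0 Mexp.
have aE : INR P = a by [].
clearbody a.
have E2 : (M ^ P * M ^ P <= exp (x / (128 * a ^ 3)))%Re.
  have H : (M ^ P <= exp (x / (256 * a ^ 3)))%Re.
    have -> : (x / (256 * a ^ 3))%Re = (INR P * (x / (256 * a ^ 4)))%Re.
      by rewrite aE; field; lra.
    by rewrite -exp_pow; apply: pow_incr; lra.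
  have -> : (x / (128 * a ^ 3))%Re = (x / (256 * a ^ 3) + x / (256 * a ^ 3))%Re.
    by field; lra.
  have MP : (0 <= M ^ P)%Re by apply: pow_le; lra.
  by rewrite exp_plus; apply: Rmult_le_compat.
set u := (/ (4 * a * (a + 1)))%Re.
have E3 : (((2 * a + 1) ^ 2) ^ B <= (4 * a * (a + 1)) ^ B * exp (INR B * u))%Re.
  apply: pow_le_exp; [nra|nra|].
  have := exp_ineq1_le u.
  have : (4 * a * (a + 1) * u = 1)%Re by rewrite /u; field; lra.
  by nra.
set v := (- / (a + 1))%Re.
have E4 : (a ^ D <= (a + 1) ^ D * exp (INR D * v))%Re.
  apply: pow_le_exp; [lra|lra|].
  have := exp_ineq1_le v.
  have : ((a + 1) * v = - 1)%Re by rewrite /v; field; lra.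
  by nra.
have E1 : (a < exp a)%Re by have := exp_ineq1_le a; lra.
have expo : (a + x / (128 * a ^ 3) + INR B * u + INR D * v <= 0)%Re.
  (* The first two exponents are at most [w <= h / 4] each and the one from [B] is at most [h],
     while the gain from [D] is at least [4 * h]. *)
  pose h := (x / (16 * a ^ 2 * (a + 1)))%Re; pose w := (x / (128 * a ^ 3))%Re.
  have a2 : (0 < a ^ 2)%Re by apply: pow_lt; lra.
  have a3 : (0 < a ^ 3)%Re by apply: pow_lt; lra.
  have aw : (a <= w)%Re.
    apply: (Rmult_le_reg_r (128 * a ^ 3)%Re); first lra.
    by rewrite /w /Rdiv Rmult_assoc Rinv_l; [nra | lra].
  have wh : (4 * w <= h)%Re.
    apply: (Rmult_le_reg_r (32 * a ^ 3 * (a + 1))%Re); first nra.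
    rewrite (_ : (4 * w * _)%Re = (x * (a + 1))%Re); last by rewrite /w; field; lra.
    rewrite (_ : (h * _)%Re = (x * (2 * a))%Re); last by rewrite /h; field; lra.
    by apply: Rmult_le_compat_l; nra.
  have Bh : (INR B * u <= h)%Re.
    apply: (Rmult_le_reg_r (16 * a ^ 2 * (a + 1))%Re); first nra.
    rewrite (_ : (INR B * u * _)%Re = (4 * a * INR B)%Re); last by rewrite /u; field; lra.
    by rewrite (_ : (h * _)%Re = x) //; rewrite /h; field; lra.
  have Dh : (4 * h <= - (INR D * v))%Re.
    apply: (Rmult_le_reg_r (4 * a ^ 2 * (a + 1))%Re); first nra.
    rewrite (_ : (4 * h * _)%Re = x); last by rewrite /h; field; lra.
    rewrite (_ : (- (INR D * v) * _)%Re = (4 * a ^ 2 * INR D)%Re) //.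
    by rewrite /v; field; lra.
  by rewrite -/w; lra.
have p1 : (0 < (4 * a * (a + 1)) ^ B)%Re by apply: pow_lt; nra.
have p2 : (0 < (a + 1) ^ D)%Re by apply: pow_lt; lra.
have p3 : (0 < ((2 * a + 1) ^ 2) ^ B)%Re by apply: pow_lt; nra.
have p4 : (0 < a ^ D)%Re by apply: pow_lt; lra.
have p5 : (0 < M ^ P * M ^ P)%Re by apply: Rmult_lt_0_compat; apply: pow_lt.
apply: (@Rlt_le_trans _ (exp a * exp (x / (128 * a ^ 3)) *
   ((4 * a * (a + 1)) ^ B * exp (INR B * u)) * ((a + 1) ^ D * exp (INR D * v)))%Re).
  apply: (@Rlt_le_trans _ (exp a * (M ^ P * M ^ P) * ((2 * a + 1) ^ 2) ^ B * a ^ D)%Re).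
    by do 3 (apply: Rmult_lt_compat_r => //).
  have ea := exp_pos a.
  apply: Rmult_le_compat => //; first by apply/Rlt_le; do 2 (apply: Rmult_lt_0_compat => //).
    by lra.
  apply: Rmult_le_compat => //; first by apply/Rlt_le; apply: Rmult_lt_0_compat.
    by lra.
  by apply: Rmult_le_compat_l => //; lra.
rewrite (_ : (_ * _ * _ * _)%Re = ((4 * a * (a + 1)) ^ B * (a + 1) ^ D *
    exp (a + x / (128 * a ^ 3) + INR B * u + INR D * v))%Re); last first.
  by rewrite !exp_plus; ring.
rewrite -[X in (_ <= X)%Re]Rmult_1_r; apply: Rmult_le_compat_l.
  by apply/Rlt_le; apply: Rmult_lt_0_compat.
by rewrite -exp_0; case: expo => [lt|->]; [left; apply: exp_increasing | right].
Qed.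

Lemma exp_bound_parameters (n t N : nat) :
  0 < n -> n <= t -> 1 < N ->
  (INR N < exp (/ 2 ^ 24 * INR n ^ 5 / INR t ^ 4))%Re ->
  exists p b D : nat,
    [/\ t <= p.+1 * (p.+1 * b.+1),
        p.+1 * b.+1 + p.+1 * (b.+1 + p.+1 * D) <= n
      & p.+1 * (N ^ p.+1 * N ^ p.+1) * ((2 * p.+1 + 1) ^ 2) ^ b.+1 * p.+1 ^ D
          < (4 * p.+1 * (p.+1 + 1)) ^ b.+1 * (p.+1 + 1) ^ D].
Proof.
move=> n0 nt N1 Nexp.
have i2 : INR 2 = 2%Re by [].
have i4 : INR 4 = 4%Re by rewrite /=; lra.
have i8 : INR 8 = 8%Re by rewrite /=; lra.
have i16 : INR 16 = 16%Re by rewrite /=; lra.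
have i128 : INR 128 = 128%Re by rewrite INR_IZR_INZ.
(* [P] is a multiple of 8 just above 8t/n; [n <= t] keeps the rounding within a factor 2. *)
have [P [P8 tP Pt]] : exists P, [/\ 8 <= P, 8 * t <= P * n & P * n <= 16 * t].
  exists (8 * (t %/ n).+1); split; first by rewrite leq_pmulr.
    by rewrite -mulnA leq_mul2l ltnW // ltn_ceil.
  rewrite -mulnA -[16]/(8 * 2) -(mulnA 8) leq_mul2l /= (mulSn (t %/ n)) mul2n -addnn.
  by rewrite leq_add // leq_divM.
have [nbigR Nexp'] : (128 * INR P ^ 4 <= INR n /\ INR N < exp (INR n / (256 * INR P ^ 4)))%Re.
  apply: (@large_ratio _ (INR t)) => //.
  - exact: (INR_leq n0).
  - exact: INR_leq.
  - by rewrite -i8; apply: INR_leq.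
  - by rewrite -i16 -!INR_muln; apply: INR_leq.
  - exact: (INR_leq N1).
have nbig : 128 * P ^ 4 <= n.
  rewrite leqNgt; apply/negP => /ltP/lt_INR.
  by rewrite INR_muln INR_expn i128; lra.
have P0 : 0 < P by apply: leq_trans P8.
(* With [P] rows of [P] phases the vertex budget is 2PB + P^2 D, and each term gets half of [n]. By
   [nbig] both quotients are positive, so rounding down at most halves them. *)
set B := n %/ (4 * P); set D := n %/ (2 * P ^ 2).
have Ble : 4 * P * B <= n by rewrite mulnC leq_divM.
have Blt : n < 4 * P * B.+1 by rewrite mulnC ltn_ceil // muln_gt0.
have Dle : 2 * P ^ 2 * D <= n by rewrite mulnC leq_divM.
have Dlt : n < 2 * P ^ 2 * D.+1 by rewrite mulnC ltn_ceil // muln_gt0 expn_gt0 P0.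
have B0 : 0 < B.
  rewrite divn_gt0 ?muln_gt0 //; apply: leq_trans nbig.
  by rewrite leq_mul // -[leqLHS]expn1 leq_pexp2l.
have D0 : 0 < D.
  rewrite divn_gt0 ?muln_gt0 ?expn_gt0 ?P0 //; apply: leq_trans nbig.
  by rewrite leq_mul // leq_pexp2l.
have Dhi : n <= 4 * P ^ 2 * D.
  apply: leq_trans (ltnW Dlt) _; rewrite mulnS -[4]/(2 + 2) 2!mulnDl.
  by rewrite leq_add2r leq_pmulr.
have Bhi : n <= 8 * P * B.
  apply: leq_trans (ltnW Blt) _; rewrite mulnS -[8]/(4 + 4) 2!mulnDl.
  by rewrite leq_add2r leq_pmulr.
clearbody B D.
case: P B P0 B0 P8 tP Pt nbigR Nexp' nbig Ble Blt Dle Dlt Dhi Bhi => // p [] // b.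
move=> P0 B0 P8 tP Pt nbigR Nexp' nbig Ble Blt Dle Dlt Dhi Bhi.
exists p, b, D; split.
- rewrite -(leq_pmul2l (isT : 0 < 8)); apply: leq_trans tP _.
  by rewrite mulnCA leq_mul2l mulnA.
- rewrite -(leq_pmul2l (isT : 0 < 2)).
  apply: leq_trans (_ : 4 * p.+1 * b.+1 + 2 * p.+1 ^ 2 * D <= _).
    by apply/eq_leq; rewrite -mulnn -!multE -!plusE; ring.
  by rewrite [leqRHS]mul2n -addnn leq_add.
apply: INR_ltn.
rewrite !(INR_muln, INR_expn, INR_addn) i2 i4.
apply: (concentration_parameters (x := INR n)) => //.
- by rewrite -i8; apply: INR_leq.
- by rewrite -i4 -!INR_muln; apply: INR_leq.
- by rewrite -i4 -INR_expn -!INR_muln; apply: INR_leq.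
- by apply: (lt_INR 0); apply/ltP/ltnW.
Qed.

From mathcomp Require Import all_order all_algebra.
From mathcomp Require Import ring lra.
Import Order.TTheory GRing.Theory Num.Theory.

Local Open Scope ring_scope.

(** * Concentration of measure in product spaces *)

Definition hamming (T : finType) b (x y : b.-tuple T) : nat := (\sum_(i < b) (tnth x i != tnth y i))%N.

Lemma hamming_cons (T : finType) b (u v : T) (x y : b.-tuple T) :
  hamming [tuple of u :: x] [tuple of v :: y] = ((u != v) + hamming x y)%N.
Proof.
rewrite /hamming big_ord_recl !tnth0; congr (_ + _)%N.
by apply: eq_bigr => i _; rewrite !tnthS.
Qed.

Lemma sum_tuple_cons (T : finType) (R : nmodType) b (f : b.+1.-tuple T -> R) :
  \sum_t f t = \sum_u \sum_(t : b.-tuple T) f [tuple of u :: t].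
Proof.
rewrite pair_big /=.
rewrite (reindex (fun p : T * b.-tuple T => [tuple of p.1 :: p.2])) //=.
exists (fun t => (thead t, [tuple of behead t])).
  by move=> [u t] _ /=; rewrite theadE; congr pair; apply: val_inj.
by move=> t _; rewrite -tuple_eta.
Qed.

Definition section (T : finType) b (A : {set b.+1.-tuple T}) (u : T) : {set b.-tuple T} :=
  [set t : b.-tuple T | [tuple of u :: t] \in A].

Lemma card_section (T : finType) b (A : {set b.+1.-tuple T}) :
  #|A| = (\sum_u #|section A u|)%N.
Proof.
rewrite -sum1_card big_mkcond /= sum_tuple_cons.
apply: eq_bigr => u _; rewrite -sum1_card [RHS]big_mkcond /=.
by apply: eq_bigr => t _; rewrite inE.
Qed.

(** The constant of Kantorovich's inequality, for the mean of g times the mean of 1/g when g ranges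
    over [1, L]. *)
Definition kantorovich (R : realFieldType) (L : R) : R := (1 + L) ^+ 2 / (4 * L).

Lemma kantorovich_sum (T : finType) (R : realFieldType) (L : R) (g : T -> R) :
  1 <= L -> (forall u, 1 <= g u <= L) ->
  (\sum_u g u) * (\sum_u (g u)^-1) <= #|T|%:R ^+ 2 * kantorovich L.
Proof.
move=> L1 gL.
(* Since [1 <= g u <= L], [(g u - 1) * (g u - L) <= 0]. *)
have pt u : g u + L * (g u)^-1 <= 1 + L.
  have /andP[g1 g2] := gL u.
  have g0 : 0 < g u by lra.
  rewrite -(ler_pM2r g0) mulrDl -mulrA mulVf ?gt_eqF // mulr1.
  by nra.
set X := \sum_u g u; set Y := \sum_u (g u)^-1; set N := #|T|%:R.
have XY : X + L * Y <= N * (1 + L).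
  rewrite /X /Y mulr_sumr -big_split /= /N mulr_natl -sumr_const.
  exact: ler_sum.
have X0 : 0 <= X by apply: sumr_ge0 => u _; have /andP[] := gL u; lra.
have Y0 : 0 <= Y.
  by apply: sumr_ge0 => u _; rewrite invr_ge0; have /andP[] := gL u; lra.
rewrite /kantorovich mulrA ler_pdivlMr; last lra.
have S0 : 0 <= X + L * Y by nra.
(* Square [XY] and use 4LXY <= (X + LY)^2. *)
have := ler_pM S0 S0 XY XY.
have := sqr_ge0 (X - L * Y).
by nra.
Qed.

(* Talagrand's exponential moment bound.  In the inductive step, [g] either stays in
   the section over the first letter of the point or moves to the largest section, at
   the cost of one unit of distance, whichever gives the better bound. *)
Lemma concentration (T : finType) (R : realFieldType) (L : R) b (A : {set b.-tuple T}) :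
  1 <= L -> (0 < #|A|)%N ->
  exists g : b.-tuple T -> nat,
    (forall z, exists2 x, x \in A & (hamming z x <= g z)%N) /\
    (\sum_z L ^+ g z) * #|A|%:R <= (#|T|%:R ^+ 2 * kantorovich L) ^+ b.
Proof.
move=> L1; have L0 : 0 < L by lra.
elim: b A => [|b IH] A A0.
  exists (fun _ => 0%N); split=> [z|].
    case/card_gt0P: A0 => x xA; exists x => //.
    by rewrite /hamming big_ord0.
  rewrite expr0 sumr_const card_tuple expn0 mul1r -[leRHS]/(1%:R) ler_nat.
  by rewrite (leq_trans (max_card _)) // card_tuple.
set mu := fun u => #|section A u|.
have [u0 mu0] : exists u0, (0 < mu u0)%N.
  case/card_gt0P: A0 => x xA; exists (thead x); apply/card_gt0P.
  by exists [tuple of behead x]; rewrite inE -tuple_eta.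
have [um _ mumax0] := @arg_maxnP _ u0 predT mu isT.
have mumax u : (mu u <= mu um)%N by exact: mumax0.
have mum0 : (0 < mu um)%N by apply: leq_trans mu0 (mumax _).
have /fin_all_exists[G GP] : forall u, exists g : b.-tuple T -> nat, (0 < mu u)%N ->
    (forall z, exists2 x, x \in section A u & (hamming z x <= g z)%N) /\
    (\sum_z L ^+ g z) * (mu u)%:R <= (#|T|%:R ^+ 2 * kantorovich L) ^+ b.
  move=> u; case: (posnP (mu u)) => [->|m0]; first by exists (fun _ => 0%N).
  by have [g Hg] := IH _ m0; exists g.
(* Staying in the section over [u] is better when that section has at least 1/L of the largest size;
   otherwise the factor [L] paid for changing the first letter is cheaper. *)
set good := fun u => (mu um)%:R <= L * (mu u)%:R :> R.
have good_gt0 u : good u -> (0 < mu u)%N.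
  rewrite /good; case: (posnP (mu u)) => // ->.
  by rewrite mulr0 lern0 (gtn_eqF mum0).
pose g (z : b.+1.-tuple T) : nat :=
  if good (thead z) then G (thead z) [tuple of behead z]
  else (G um [tuple of behead z]).+1.
exists g; split.
  move=> z; rewrite (tuple_eta z) /g theadE.
  have -> : [tuple of behead [tuple of thead z :: [tuple of behead z]]]
      = [tuple of behead z] by apply: val_inj.
  case: ifP => [gd|_].
    have [Hz _] := GP _ (good_gt0 _ gd).
    have [x xA hx] := Hz [tuple of behead z].
    exists [tuple of thead z :: x]; first by rewrite inE in xA.
    by rewrite hamming_cons eqxx.
  have [Hz _] := GP _ mum0.
  have [x xA hx] := Hz [tuple of behead z].
  exists [tuple of um :: x]; first by rewrite inE in xA.
  by rewrite hamming_cons; apply: (leq_add (leq_b1 _) hx).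
set K := #|T|%:R ^+ 2 * kantorovich L.
have mR : 0 < (mu um)%:R :> R by rewrite ltr0n.
(* One factor [h u] in [1, L] controls both sides: the moment over [u] grows at most by [h u], and
   the section over [u] is smaller than the largest by at least [h u]. Hence [kantorovich_sum]
   closes the induction. *)
pose h u : R := if good u then (mu um)%:R / (mu u)%:R else L.
have h1 u : 1 <= h u <= L.
  rewrite /h; case: ifP => [gd|_]; last by rewrite L1 lexx.
  have m0 : 0 < (mu u)%:R :> R by rewrite ltr0n good_gt0.
  rewrite ler_pdivlMr // mul1r ler_nat mumax //=.
  by rewrite ler_pdivrMr.
have K0 : 0 <= K ^+ b.
  rewrite exprn_ge0 // mulr_ge0 ?exprn_ge0 // divr_ge0 ?exprn_ge0 //; lra.
have hmu u : (mu u)%:R <= (mu um)%:R / h u.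
  rewrite /h; case: ifP => [gd|/negbT].
    have m0 : 0 < (mu u)%:R :> R by rewrite ltr0n good_gt0.
    by rewrite invf_div mulrCA divff ?mulr1 // gt_eqF.
  by rewrite -ltNge => ngd; rewrite ler_pdivlMr // mulrC ltW.
have hG u : \sum_(t : b.-tuple T) L ^+ g [tuple of u :: t] <= K ^+ b / (mu um)%:R * h u.
  have eqg (t : b.-tuple T) : g [tuple of u :: t] = if good u then G u t else (G um t).+1.
    rewrite /g theadE.
    by have -> : [tuple of behead [tuple of u :: t]] = t by apply: val_inj.
  under eq_bigr do rewrite eqg.
  rewrite /h; case: ifP => [gd|_].
    have m0 : 0 < (mu u)%:R :> R by rewrite ltr0n good_gt0.
    have [_] := GP _ (good_gt0 _ gd).
    rewrite -ler_pdivlMr // => Hm.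
    by rewrite [leRHS]mulrA divfK ?gt_eqF.
  have [_] := GP _ mum0.
  rewrite -ler_pdivlMr // => Hm.
  under eq_bigr do rewrite exprS.
  by rewrite -mulr_sumr mulrC ler_wpM2r // ltW.
rewrite sum_tuple_cons card_section natr_sum exprS.
apply: le_trans (ler_pM _ _ (ler_sum _ (fun u _ => hG u)) (ler_sum _ (fun u _ => hmu u))) _.
- by apply: sumr_ge0 => u _; apply: sumr_ge0 => t _; rewrite exprn_ge0 // ltW.
- by apply: sumr_ge0.
rewrite -!mulr_sumr mulrACA divfK ?gt_eqF // [leRHS]mulrC.
by rewrite ler_wpM2l // kantorovich_sum.
Qed.

(** By Markov's inequality for [L ^ g i z] with L = 1 + 1/tau, few [z] have [g i z > D], and a union
    bound over [i] leaves a point outside all bad sets. The numerical hypothesis is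
    [#|I| * N * kantorovich L ^ b < L ^ D] with denominators cleared. *)
Lemma common_center (T I : finType) b (A : I -> {set b.-tuple T}) (N D tau : nat) :
  (0 < #|T|)%N -> (0 < tau)%N ->
  (forall i, (#|T| ^ b <= #|A i| * N)%N) ->
  (#|I| * N * ((2 * tau + 1) ^ 2) ^ b * tau ^ D
     < (4 * tau * (tau + 1)) ^ b * (tau + 1) ^ D)%N ->
  exists z, forall i, exists2 x, x \in A i & (hamming z x <= D)%N.
Proof.
move=> T0 tau0 dense num.
have tauR : 0 < tau%:R :> rat by rewrite ltr0n.
pose L : rat := (tau + 1)%:R / tau%:R.
have L1 : 1 <= L by rewrite ler_pdivlMr // mul1r ler_nat leq_addr.
have L0 : 0 < L by lra.
have cE : kantorovich L = ((2 * tau + 1) ^ 2)%:R / (4 * tau * (tau + 1))%:R.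
  rewrite /kantorovich /L !(natrX, natrM, natrD).
  by field; apply/andP; split; rewrite gt_eqF //; lra.
have numR : #|I|%:R * N%:R * kantorovich L ^+ b < L ^+ D.
  rewrite cE /L !expr_div_n ltr_pdivlMr ?exprn_gt0 //.
  rewrite mulrA mulrAC ltr_pdivrMr; last by rewrite exprn_gt0 // ltr0n !muln_gt0 tau0 addn1.
  rewrite -!natrX -!natrM ltr_nat.
  by rewrite [ltnRHS]mulnC.
have A0 i : (0 < #|A i|)%N.
  by rewrite lt0n; apply: contraL (dense i) => /eqP->; rewrite mul0n -ltnNge expn_gt0 T0.
have /fin_all_exists[g gP] := fun i => concentration L1 (A0 i).
pose bad i := [set z | (D < g i z)%N].
have hbad i : #|bad i|%:R * L ^+ D <= N%:R * #|T|%:R ^+ b * kantorovich L ^+ b.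
  have [_ H] := gP i.
  have Tb : 0 < #|T|%:R ^+ b :> rat by rewrite exprn_gt0 // ltr0n.
  have H1 : #|bad i|%:R * L ^+ D <= \sum_z L ^+ g i z.
    rewrite mulr_natl -sumr_const.
    rewrite [leRHS](bigID (mem (bad i))) /= ler_wpDr //.
      by apply: sumr_ge0 => z _; rewrite exprn_ge0 // ltW.
    apply: ler_sum => z; rewrite inE => Dg.
    by rewrite ler_weXn2l // ltnW.
  have B0 : 0 <= #|bad i|%:R * L ^+ D by rewrite mulr_ge0 // exprn_ge0 // ltW.
  rewrite -(ler_pM2r Tb).
  have Hd : #|T|%:R ^+ b <= #|A i|%:R * N%:R :> rat.
    by rewrite -natrX -natrM ler_nat.
  apply: le_trans (ler_wpM2l B0 Hd) _.
  rewrite mulrA.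
  apply: le_trans (ler_wpM2r (ler0n _ N) (ler_wpM2r (ler0n _ _) H1)) _.
  apply: le_trans (ler_wpM2r (ler0n _ N) H) _.
  by rewrite exprMn -exprM mulnC exprM expr2 le_eqVlt; apply/orP; left; apply/eqP; ring.
have lt : (#|\bigcup_i bad i| < #|[set: b.-tuple T]|)%N.
  rewrite cardsT card_tuple.
  apply: leq_ltn_trans (_ : (\sum_i #|bad i| < _)%N).
    elim/big_ind2: _ => [|m X m' Y hX hY|i _] //; first by rewrite cards0.
    exact: leq_trans (leq_card_setU _ _) (leq_add hX hY).
  rewrite -(ltr_nat rat) -(ltr_pM2r (exprn_gt0 D L0)) natr_sum mulr_suml.
  apply: le_lt_trans (ler_sum _ (fun i _ => hbad i)) _.
  rewrite sumr_const -mulr_natl natrX.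
  have Tb : 0 < #|T|%:R ^+ b :> rat by rewrite exprn_gt0 // ltr0n.
  rewrite [ltLHS](_ : _ = #|T|%:R ^+ b * (#|I|%:R * N%:R * kantorovich L ^+ b)).
    by rewrite ltr_pM2l.
  by ring.
have /subsetPn[z _ zP] : ~~ ([set: b.-tuple T] \subset \bigcup_i bad i).
  by apply: contraL lt => /subset_leq_card; rewrite -leqNgt.
exists z => i; have [/(_ z)[x xA hx] _] := gP i.
exists x => //; apply: leq_trans hx _.
by rewrite leqNgt; apply: contra zP => Dg; apply/bigcupP; exists i; rewrite ?inE.
Qed.

Local Close Scope ring_scope.

(** * Construction of the two words *)

Lemma pigeonhole (S T : finType) (U : {set S}) (f : S -> T) :
  0 < #|T| -> exists t, #|U| <= #|[set s in U | f s == t]| * #|T|.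
Proof.
case/card_gt0P=> t0 _.
have [t _ tmax] := @arg_maxnP _ t0 predT (fun t => #|[set s in U | f s == t]|) isT.
exists t; rewrite -sum1_card (partition_big f xpredT) //= mulnC -sum_nat_const.
apply: leq_sum => u _; apply: leq_trans (tmax u isT).
by rewrite sum1dep_card; apply/eq_leq/eq_card => s; rewrite !inE.
Qed.

Lemma run_add (Q A : Type) (q : Q) (delta : Q -> A -> Q) w i j :
  run q delta w (i + j) = run (run q delta w i) delta (fun e => w (i + e)) j.
Proof. by elim: j => [|j IH]; rewrite ?addn0 // addnS /= IH. Qed.

Lemma eq_run (Q A : Type) (q : Q) (delta : Q -> A -> Q) w w' m :
  (forall e, e < m -> w e = w' e) -> run q delta w m = run q delta w' m.
Proof. by elim: m => //= m IH eqw; rewrite IH ?eqw // => e em; apply/eqw/ltnW. Qed.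

(** A position and one of its slots. Sizes are successors so that ['I_p.+1] carries the cyclic group
    in which shifts are added. *)
Definition slot p b : finType := ('I_b.+1 * 'I_p.+1)%type.

(** The boolean is the 0-based priority: 2 on the last letter of the row, 1 before. Even and odd
    rows differ only in [x], the slot chosen at each time. *)
Definition row_letter n p b (occ : slot p b -> 'I_n) (x : nat -> 'I_p.+1) (e : nat) :
    Sigma n 2 :=
  (occ (inord (e %% b.+1), x e), inord (e.+1 == p.+1 * b.+1)).

Definition shift p b (a : b.+1.-tuple 'I_p.+1) (e : nat) : 'I_p.+1 :=
  (tnth a (inord (e %% b.+1)) + inZp (e %/ b.+1))%R.

Definition translate p b (j : 'I_p.+1) (a : b.+1.-tuple 'I_p.+1) :=
  [tuple (tnth a l + j)%R | l < b.+1].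

Lemma translate_inj p b (j : 'I_p.+1) : injective (@translate p b j).
Proof.
move=> a a' eq_aa'; apply: eq_from_tnth => l.
by move/(congr1 (fun t => tnth t l)): eq_aa'; rewrite !tnth_mktuple => /addIr.
Qed.

(** Shifts that agree on the states at phase ends can be exchanged there, so each phase may follow
    its own shift. Phase [j] of a shift [a] reads the slots of [translate j a], and translation
    preserves cardinality, so [common_center] applies to the translates. *)
Lemma fooling_row n p b (Q : finType) (delta : Q -> Sigma n 2 -> Q) (q q' : Q)
    (occ : slot p b -> 'I_n) (U : {set b.+1.-tuple 'I_p.+1}) (N D tau : nat) :
  0 < tau -> p.+1 ^ b.+1 <= #|U| * N ->
  p.+1 * (#|Q| ^ p.+1 * N) * ((2 * tau + 1) ^ 2) ^ b.+1 * tau ^ D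
    < (4 * tau * (tau + 1)) ^ b.+1 * (tau + 1) ^ D ->
  (forall a, a \in U -> run q delta (row_letter occ (shift a)) (p.+1 * b.+1) = q') ->
  exists (x : nat -> 'I_p.+1) (Y : {set slot p b}),
    [/\ #|Y| <= b.+1 + p.+1 * D,
        forall e, e < p.+1 * b.+1 -> (inord (e %% b.+1), x e) \in Y
      & run q delta (row_letter occ x) (p.+1 * b.+1) = q'].
Proof.
move=> tau0 Ubig num Uq'.
pose traj (a : b.+1.-tuple 'I_p.+1) : {ffun 'I_p.+1 -> Q} :=
  [ffun j : 'I_p.+1 => run q delta (row_letter occ (shift a)) (j.+1 * b.+1)].
have [|T Tbig] := @pigeonhole _ {ffun 'I_p.+1 -> Q} U traj.
  by apply/card_gt0P; exists [ffun=> q].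
set U' := [set a in U | traj a == T] in Tbig.
have cardF : #|{ffun 'I_p.+1 -> Q}| = #|Q| ^ p.+1 by rewrite card_ffun card_ord.
have [|||z zP] := @common_center 'I_p.+1 'I_p.+1 b.+1 (fun j => translate j @: U')
    (#|Q| ^ p.+1 * N) D tau _ tau0; rewrite ?card_ord //.
  move=> j; rewrite card_imset; last exact: translate_inj.
  rewrite mulnA -cardF; apply: leq_trans Ubig _.
  by rewrite leq_mul2r Tbig orbT.
have /fin_all_exists[a aP] : forall j, exists a, a \in U' /\ hamming z (translate j a) <= D.
  by move=> j; have [_ /imsetP[a aU ->] hza] := zP j; exists a.
pose off j := [set l | tnth z l != tnth (translate j (a j)) l].
(* The slots of the centre [z], plus, for each phase, the at most [D] slots where the chosen
   translate leaves [z]. *)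
pose Y := [set (l, tnth z l) | l : 'I_b.+1] :|:
  \bigcup_(j : 'I_p.+1) [set (l, tnth (translate j (a j)) l) | l in off j].
pose x e := shift (a (inord (e %/ b.+1))) e.
exists x, Y; split.
- apply: leq_trans (leq_card_setU _ _) _; apply: leq_add.
    by apply: leq_trans (leq_imset_card _ _) _; rewrite card_ord.
  apply: (@leq_trans (\sum_(j : 'I_p.+1) D)); last by rewrite sum_nat_const card_ord.
  elim/big_ind2: _ => [|X m X' m' hX hX'|j _]; first by rewrite cards0.
    exact: leq_trans (leq_card_setU _ _) (leq_add hX hX').
  apply: leq_trans (leq_imset_card _ _) _; have [_] := aP j; apply: leq_trans.
  by rewrite /hamming -big_mkcond -sum1_card; apply/eq_leq/eq_big => // l; rewrite inE.
- move=> e eL; set l := inord _; set j : 'I_p.+1 := inord (e %/ b.+1).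
  have jE : inZp (e %/ b.+1) = j.
    by apply: val_inj; rewrite /= inordK ?modn_small // ltn_divLR.
  have -> : x e = tnth (translate j (a j)) l by rewrite tnth_mktuple /x /shift jE.
  case: (eqVneq (tnth z l) (tnth (translate j (a j)) l)) => [<-|ne].
    by apply/setUP; left; apply: imset_f.
  apply/setUP; right; apply/bigcupP; exists j => //; apply/imsetP; exists l => //.
  by rewrite inE.
(* Before each phase the common trajectory allows replacing [a'] by the shift that [x] follows in
   that phase. *)
have runx j a' : j <= p.+1 -> a' \in U' ->
    run q delta (row_letter occ x) (j * b.+1)
      = run q delta (row_letter occ (shift a')) (j * b.+1).
  elim: j a' => [|j IH] a' jp a'U //.
  have [aU _] := aP (inord j).
  have -> : run q delta (row_letter occ (shift a')) (j.+1 * b.+1)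
          = run q delta (row_letter occ (shift (a (inord j)))) (j.+1 * b.+1).
    move: a'U aU; rewrite !inE => /andP[_ /eqP e1] /andP[_ /eqP]; rewrite -e1.
    by move/ffunP/(_ (Ordinal jp)); rewrite !ffunE.
  rewrite mulSn addnC !run_add (IH _ (ltnW jp) aU); apply: eq_run => e eb.
  by rewrite /row_letter /x divnMDl // divn_small // addn0.
have [aU _] := aP ord0.
rewrite (runx _ _ (leqnn _) aU); apply: Uq'.
by move: aU; rewrite inE => /andP[].
Qed.

(* [occ c] is the occupation of the slots during row [c], [Y c] the set of slots that
   the odd word visits in that row, [U] the set of shifts still possible for the even
   word, and [V] the set of vertices used so far. *)
Lemma fooling_chain n p b (Q : finType) (delta : Q -> Sigma n 2 -> Q) (q0 : Q)
    (k D tau : nat) :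
  0 < tau ->
  p.+1 * b.+1 + k * (b.+1 + p.+1 * D) <= n ->
  p.+1 * (#|Q| ^ p.+1 * #|Q| ^ k) * ((2 * tau + 1) ^ 2) ^ b.+1 * tau ^ D
    < (4 * tau * (tau + 1)) ^ b.+1 * (tau + 1) ^ D ->
  forall i, i <= k ->
  exists (occ : nat -> slot p b -> 'I_n) (x : nat -> nat -> 'I_p.+1)
    (Y : nat -> {set slot p b}) (q : nat -> Q)
    (U : {set b.+1.-tuple 'I_p.+1}) (V : {set 'I_n}),
    [/\ q 0 = q0,
        p.+1 ^ b.+1 <= #|U| * #|Q| ^ i
          /\ #|V| <= p.+1 * b.+1 + i * (b.+1 + p.+1 * D),
        forall c s, c <= i -> occ c s \in V,
        (forall c c' s s', c <= i -> c' <= i -> occ c s = occ c' s' -> s = s')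
          /\ (forall c c' s s', c < c' -> c' <= i -> s \in Y c -> occ c s <> occ c' s')
      & forall c, c < i ->
          [/\ forall e, e < p.+1 * b.+1 -> (inord (e %% b.+1), x c e) \in Y c,
              run (q c) delta (row_letter (occ c) (x c)) (p.+1 * b.+1) = q c.+1
            & forall a, a \in U ->
                run (q c) delta (row_letter (occ c) (shift a)) (p.+1 * b.+1) = q c.+1]].
Proof.
move=> tau0 vertices num.
have card_slot : #|{: slot p b}| = p.+1 * b.+1.
  by rewrite card_prod !card_ord mulnC.
elim=> [_|i IH ik].
  have le_n : #|{: slot p b}| <= n by rewrite card_slot (leq_trans _ vertices) ?leq_addr.
  pose f (s : slot p b) := widen_ord le_n (enum_rank s).
  exists (fun _ => f), (fun _ _ => ord0), (fun _ => set0), (fun _ => q0), setT, (f @: setT).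
  split=> //.
  - rewrite cardsT card_tuple card_ord expn0 muln1 addn0; split=> //.
    by rewrite -card_slot -cardsT leq_imset_card.
  - by move=> c s _; apply: imset_f.
  - split=> [c c' s s' _ _|c c' s s' _ _]; last by rewrite inE.
    by move/(congr1 (@nat_of_ord n)) => /= /ord_inj /enum_rank_inj.
have [occ [x [Y [q [U [V [q0E [Ubig Vsmall] occV [inj away] rows]]]]]]] := IH (ltnW ik).
have Q0 : 0 < #|Q| by apply/card_gt0P; exists q0.
pose rw (a : b.+1.-tuple 'I_p.+1) := run (q i) delta (row_letter (occ i) (shift a)) (p.+1 * b.+1).
have [q' U'big] := pigeonhole U rw Q0.
set U' := [set a in U | rw a == q'] in U'big.
(* The single value [#|Q| ^ k] serves every row, since the density of [U'] is at least 1/|Q|^(i+1)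
   and i < k. *)
have [|a|xi [Yi [Yismall xY runx]]] :=
    @fooling_row n p b Q delta (q i) q' (occ i) U' (#|Q| ^ k) D tau tau0 _ num.
- apply: leq_trans Ubig _; apply: leq_trans (leq_mul U'big (leqnn _)) _.
  by rewrite -mulnA -expnS leq_mul2l leq_pexp2l ?orbT.
- by rewrite inE => /andP[_ /eqP].
have room : #|Yi| <= #|~: V|.
  rewrite [#|~: V|]cardsCs setCK card_ord leq_subRL; last first.
    by rewrite (leq_trans Vsmall) // (leq_trans _ vertices) // leq_add2l leq_mul2r ltnW ?orbT.
  apply: leq_trans (leq_add Vsmall Yismall) _; apply: leq_trans vertices.
  by rewrite -addnA leq_add2l addnC -mulSn leq_mul2r ik orbT.
pose fresh s := nth (occ i s) (enum (~: V)) (index s (enum Yi)).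
have idx s : s \in Yi -> index s (enum Yi) < size (enum (~: V)).
  by move=> sY; rewrite -cardE (leq_trans _ room) // cardE index_mem mem_enum.
have freshV s : s \in Yi -> fresh s \notin V.
  by move=> sY; have := mem_nth (occ i s) (idx s sY); rewrite mem_enum inE.
have fresh_inj s s' : s \in Yi -> s' \in Yi -> fresh s = fresh s' -> s = s'.
  move=> sY s'Y; rewrite /fresh (set_nth_default (occ i s')) ?idx // => /eqP.
  rewrite nth_uniq ?idx ?enum_uniq // => /eqP eq_idx.
  by rewrite -(nth_index s (_ : s \in enum Yi)) ?mem_enum // eq_idx nth_index ?mem_enum.
pose new s := if s \in Yi then fresh s else occ i s.
pose occ' c := if c <= i then occ c else new.
have occ'E c : c <= i -> occ' c = occ c by rewrite /occ' => ->.
have occ'S : occ' i.+1 = new by rewrite /occ' ltnn.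
exists occ', (fun c => if c < i then x c else xi), (fun c => if c < i then Y c else Yi),
  (fun c => if c <= i then q c else q'), U', (V :|: fresh @: Yi).
split.
- by [].
- split.
    rewrite (expnS #|Q|) mulnA; apply: leq_trans Ubig _.
    by rewrite leq_mul2r U'big orbT.
  apply: leq_trans (leq_card_setU _ _) _.
  by rewrite (mulSn i) [leqRHS]addnCA [leqRHS]addnC leq_add // (leq_trans (leq_imset_card _ _)).
- move=> c s; rewrite leq_eqVlt => /orP[/eqP->|ci]; last by rewrite occ'E // inE occV.
  by rewrite occ'S /new inE; case: ifP => sY; [rewrite imset_f ?orbT | rewrite occV].
- have notnew c s s' : c <= i -> s' \in Yi -> occ c s <> fresh s'.
    by move=> ci s'Y eq; move: (freshV _ s'Y); rewrite -eq occV.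
  split=> c c' s s'.
    rewrite leq_eqVlt => /orP[/eqP->|ci]; rewrite leq_eqVlt => /orP[/eqP->|c'i];
      rewrite ?occ'S ?(occ'E c) ?(occ'E c') // /new.
    + case: ifP => sY; case: ifP => s'Y; first exact: fresh_inj.
      * by move/esym/(notnew _ _ _ (leqnn i)).
      * by move/notnew => /(_ (leqnn i)).
      * exact: inj.
    + by case: ifP => sY; [move/esym/notnew => /(_ c'i sY) | apply: inj].
    + by case: ifP => sY; [move/notnew => /(_ ci sY) | apply: inj].
    + exact: inj.
  (* A vertex of row [i.+1] is either fresh or kept in its slot from row [i]. A kept one lies
     outside [Yi], and [away] up to row [i] deals with the earlier rows. *)
  move=> cc'; rewrite leq_eqVlt => /orP[/eqP c'E|c'i]; last first.
    have ci : c < i := leq_trans cc' c'i.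
    by rewrite ci (occ'E c (ltnW ci)) (occ'E c' c'i); apply: away.
  have ci : c <= i by rewrite -ltnS -c'E.
  rewrite c'E occ'S (occ'E c ci) /new; move: ci; rewrite leq_eqVlt => /orP[/eqP->|ci].
    rewrite ltnn => sY; case: ifP => s'Y; first by apply: notnew.
    by move/(inj i i _ _ (leqnn _) (leqnn _)) => ss'; rewrite -ss' sY in s'Y.
  rewrite ci => sY; case: ifP => s'Y; first by apply: notnew => //; apply: ltnW.
  exact: away.
- move=> c lt_c; have /predU1P[->|ci] : (c == i) || (c < i) by rewrite -leq_eqVlt.
    rewrite /= leqnn !ltnn (occ'E i) //; split=> // a.
    by rewrite inE => /andP[_ /eqP].
  rewrite /= ci (ltnW ci) (occ'E c (ltnW ci)).
  have [r1 r2 r3] := rows c ci; split=> // a.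
  by rewrite inE => /andP[aU _]; apply: r3.
Qed.

(** * Concatenation of rows into infinite words *)

Definition rows_then (A : Type) (k L : nat) (r : nat -> nat -> A) (tail : A) (i : nat) : A :=
  if i < k * L then r (i %/ L) (i %% L) else tail.

Lemma rows_thenE (A : Type) k L (r : nat -> nat -> A) tail c e :
  c < k -> e < L -> rows_then k L r tail (c * L + e) = r c e.
Proof.
move=> ck eL; have L0 : 0 < L by apply: leq_ltn_trans eL.
have lt : c * L + e < k * L.
  by apply: (@leq_trans (c.+1 * L)); rewrite ?leq_mul2r ?ck ?orbT // mulSn addnC ltn_add2r.
by rewrite /rows_then lt divnMDl // modnMDl divn_small // modn_small // addn0.
Qed.

(** Membership in the languages is checked on consecutive letters, which meet inside a row, between
    rows, at the start of the tail, or within it. *)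
Lemma rows_then_step (A : Type) (P : A -> A -> Prop) k L (r : nat -> nat -> A) tail :
  0 < L ->
  (forall c e, c < k -> e.+1 < L -> P (r c e) (r c e.+1)) ->
  (forall c, c.+1 < k -> P (r c L.-1) (r c.+1 0)) ->
  (forall c, c.+1 = k -> P (r c L.-1) tail) ->
  P tail tail ->
  forall i, P (rows_then k L r tail i) (rows_then k L r tail i.+1).
Proof.
move=> L0 inrow nextrow lastrow Ptail i.
case: (ltnP i (k * L)) => ik; last by rewrite /rows_then !ltnNge ik leqW.
have ck : i %/ L < k by rewrite ltn_divLR.
rewrite (divn_eq i L); set c := i %/ L in ck *; set e := i %% L.
have eL : e < L by rewrite ltn_mod.
rewrite rows_thenE // -addnS.
have [eL'|/eqP eL'] : e.+1 < L \/ e.+1 == L by move: eL; rewrite leq_eqVlt => /orP[]; auto.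
  by rewrite rows_thenE //; apply: inrow.
have -> : e = L.-1 by rewrite -eL'.
rewrite prednK // addnC -mulSn.
move: ck; rewrite leq_eqVlt => /orP[/eqP cE|ck].
  by rewrite /rows_then cE ltnn; apply: lastrow.
by rewrite -[_ * L]addn0 rows_thenE //; apply: nextrow.
Qed.

Lemma run_rows_then (Q A : Type) (delta : Q -> A -> Q) k L (r : nat -> nat -> A) tail (q : nat -> Q) :
  (forall c, c < k -> run (q c) delta (r c) L = q c.+1) ->
  run (q 0) delta (rows_then k L r tail) (k * L) = q k.
Proof.
move=> rowsP.
suff H c : c <= k -> run (q 0) delta (rows_then k L r tail) (c * L) = q c by apply: H.
elim: c => [|c IH] ck //.
rewrite mulSn addnC run_add IH ?(ltnW ck) // -rowsP //.
by apply: eq_run => e eL; rewrite rows_thenE.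
Qed.

(** * Graphs whose cycles all have the same parity *)

(** The edge leaving a vertex of maximal rank on the cycle cannot increase the rank, so it has
    priority 2. *)
Lemma even_rank_graph (E : nat -> nat -> bool) (rank : nat -> nat) :
  graph_parity true E (fun u v => if rank u < rank v then 1 else 2).
Proof.
move=> s s0 _; set pi := fun u v => _.
suff -> : cycle_max pi s = 2 by [].
apply/eqP; rewrite eqn_leq; apply/andP; split.
  by apply/bigmax_leqP => i _; rewrite /pi; case: ifP.
have [i _ imax] := @arg_maxnP _ (Ordinal s0) predT (fun i => rank (nth 0 s i)) isT.
rewrite /cycle_max (bigD1 i) //= leq_max; apply/orP; left.
have lt : i.+1 %% size s < size s by rewrite ltn_mod.
by rewrite /pi ifN // -leqNgt; apply: (imax (Ordinal lt)).
Qed.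

(** A class that never decreases along edges is constant on a cycle, so no edge of priority 2 occurs
    there. *)
Lemma odd_class_graph (E : nat -> nat -> bool) (cls : nat -> nat) :
  (forall u v, E u v -> cls u <= cls v) ->
  graph_parity false E (fun u v => if cls u == cls v then 1 else 2).
Proof.
move=> mono s s0 Es; set pi := fun u v => _.
have const i : i < size s -> cls (nth 0 s i) = cls (nth 0 s (i.+1 %% size s)).
  case: s s0 Es => // x s _ /= xs.
  (* Repeating the first vertex at the end opens the cycle into a path whose classes are
     nondecreasing and return to their first value. *)
  have sorted_cls : sorted leq (map cls (x :: rcons s x)).
    by rewrite /= path_map; apply: sub_path xs => u v /mono.
  have nth_mono m m' : m <= m' -> m' <= (size s).+1 ->
      cls (nth 0 (x :: rcons s x) m) <= cls (nth 0 (x :: rcons s x) m').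
    move=> mm' m's; rewrite -!(nth_map 0 0 cls) /= ?size_rcons ?ltnS //;
      last exact: leq_trans mm' _.
    have := sorted_leq_nth leq_trans leqnn 0 sorted_cls.
    by apply; rewrite ?inE /= ?size_map ?size_rcons ?ltnS // (leq_trans mm').
  have all_eq m : m <= (size s).+1 -> cls (nth 0 (x :: rcons s x) m) = cls x.
    move=> ms; apply/eqP; rewrite eqn_leq.
    have := nth_mono _ _ ms (leqnn _); rewrite /= nth_rcons ltnn eqxx => ->.
    exact: (nth_mono 0 m).
  have nthE m : m < (size s).+1 -> nth 0 (x :: s) m = nth 0 (x :: rcons s x) m.
    by case: m => //= m ms; rewrite nth_rcons -ltnS ms.
  move=> im; have lt : i.+1 %% (size s).+1 < (size s).+1 by rewrite ltn_mod.
  by rewrite !nthE // !all_eq // ltnW.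
suff -> : cycle_max pi s = 1 by [].
rewrite /cycle_max (eq_bigr (fun _ => 1)); last by move=> i _; rewrite /pi const ?eqxx.
apply/eqP; rewrite eqn_leq; apply/andP; split; first exact/bigmax_leqP.
by rewrite (bigD1 (Ordinal s0)) //= leq_max.
Qed.

(** * Membership in the two languages *)

Definition complete n (u v : nat) : bool := (u < n) && (v < n).

Lemma complete_game_graph n pi :
  (forall u v, 1 <= pi u v <= 2) -> is_game_graph 2 n (complete n) pi.
Proof.
move=> pi12; split; first by move=> u v /andP.
by split=> [u un|u v _]; [exists u; apply/andP | apply: pi12].
Qed.

(** The witness is the complete graph with loops: the rank alone settles the parity of every cycle,
    so only the labels of the word need checking. *)
Lemma even_cycles_rank n (rank : nat -> nat) (w : nat -> Sigma n 2) :
  (forall i, (if rank (w i).1 < rank (w i.+1).1 then 1 else 2) = ((w i).2 : nat).+1) ->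
  EvenCycles n 2 w.
Proof.
move=> label; exists n, (complete n), (fun u v => if rank u < rank v then 1 else 2).
split=> //; split; first by apply: complete_game_graph => u v; case: ifP.
by split=> [|i]; [apply: even_rank_graph | rewrite /complete !ltn_ord].
Qed.

Lemma odd_cycles_class n (cls : nat -> nat) (w : nat -> Sigma n 2) :
  (forall i, cls (w i).1 <= cls (w i.+1).1 /\
     (if cls (w i).1 == cls (w i.+1).1 then 1 else 2) = ((w i).2 : nat).+1) ->
  OddCycles n 2 w.
Proof.
move=> label; exists n, (fun u v => complete n u v && (cls u <= cls v)),
  (fun u v => if cls u == cls v then 1 else 2).
split=> //; split.
  split; first by move=> u v /andP[/andP].
  by split=> [u un|u v _]; [exists u; rewrite /complete un leqnn | case: ifP].
split=> [|i]; first by apply: odd_class_graph => u v /andP[].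
by have [cls_le ->] := label i; rewrite /complete !ltn_ord.
Qed.

(** * The lower bound *)

Lemma row_letter_label n p b (occ : slot p b -> 'I_n) x e :
  ((row_letter occ x e).2 : nat) = (e.+1 == p.+1 * b.+1).
Proof. by rewrite /= inordK //; case: eqP. Qed.

(** At time [k * L], which is at least [t], both words are in state [q k]: the even word has to be
    accepted there and the odd one rejected. *)
Lemma fooled_separator n p b (Q : finType) (delta : Q -> Sigma n 2 -> Q) (q0 : Q)
    (k D tau t : nat) :
  0 < tau -> 0 < t -> t <= k * (p.+1 * b.+1) ->
  p.+1 * b.+1 + k * (b.+1 + p.+1 * D) <= n ->
  p.+1 * (#|Q| ^ p.+1 * #|Q| ^ k) * ((2 * tau + 1) ^ 2) ^ b.+1 * tau ^ D
    < (4 * tau * (tau + 1)) ^ b.+1 * (tau + 1) ^ D ->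
  ~ separates q0 delta (EvenCycles n 2) (OddCycles n 2) t.
Proof.
move=> tau0 t0 tk vertices num [qacc sep].
have [occ [x [Y [q [U [V [q0E [Ubig _] _ [inj away] rows]]]]]]] :=
  fooling_chain delta q0 tau0 vertices num (leqnn k).
have [a aU] : exists a, a \in U.
  apply/card_gt0P; rewrite lt0n; apply: contraL Ubig => /eqP->.
  by rewrite mul0n -ltnNge expn_gt0.
set L := p.+1 * b.+1 in tk rows *.
have L0 : 0 < L by [].
(* The tail loops on an occupant of row [k]; by [away] the odd word has not met it in its rows, so
   it can form a last class of its own. *)
pose f := occ k (ord0, ord0).
have kL0 : 0 < k * L by apply: leq_trans tk.
have k0 : 0 < k by move: kL0; rewrite muln_gt0 => /andP[].
pose w := rows_then k L (fun c => row_letter (occ c) (shift a)) (f, inord 1).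
pose y := rows_then k L (fun c => row_letter (occ c) (x c)) (f, inord 0).
have runw : run q0 delta w (k * L) = q k.
  rewrite -q0E; apply: run_rows_then => c ck.
  by have [_ _] := rows c ck; apply.
have runy : run q0 delta y (k * L) = q k.
  by rewrite -q0E; apply: run_rows_then => c ck; have [] := rows c ck.
have evenw : EvenCycles n 2 w.
  (* The position in the row, phase first, at which every row of [w] visits [u]. *)
  pose rank (u : nat) :=
    if [pick cs : 'I_k.+1 * slot p b | (occ cs.1 cs.2 : nat) == u] is Some cs
    then nat_of_ord (cs.2.2 - tnth a cs.2.1)%R * b.+1 + cs.2.1 else 0.
  have rankE c s : c <= k ->
      rank (occ c s) = nat_of_ord (s.2 - tnth a s.1)%R * b.+1 + s.1.
    move=> ck; rewrite /rank; case: pickP => [[c' s'] /= /eqP/ord_inj eq|/(_ (Ordinal (ck : c < k.+1), s))].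
      by rewrite (inj c' c s' s _ ck eq) // -ltnS.
    by rewrite /= eqxx.
  have rank_row c e : c <= k -> e < L ->
      rank (row_letter (occ c) (shift a) e).1 = e.
    move=> ck eL; change (rank (occ c (inord (e %% b.+1), shift a e)) = e).
    rewrite rankE // [(_, _).2]/= [(_, _).1]/= /shift addrAC subrr add0r.
    rewrite inordK ?ltn_mod //= modn_small -?divn_eq //.
    by rewrite ltn_divLR.
  (* The last letter of a row has the largest possible rank, so the edge into the tail has priority
     2 whatever the rank of [f]. *)
  have rank_max u : rank u <= L.-1.
    rewrite -ltnS prednK // /rank; case: pickP => // cs _; set o := (_ - _)%R; apply: (@leq_trans (o.+1 * b.+1)).
      by rewrite mulSn addnC ltn_add2r.
    by rewrite leq_mul2r ltn_ord orbT.
  apply: (@even_cycles_rank _ rank); apply: (@rows_then_step _ (fun u v : Sigma n 2 =>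
      (if rank u.1 < rank v.1 then 1 else 2) = (u.2 : nat).+1)) => //.
  - move=> c e ck eL; rewrite !rank_row ?(ltnW ck) ?(ltnW eL) // ltnSn row_letter_label.
    by rewrite (ltn_eqF eL).
  - move=> c ck; rewrite row_letter_label prednK // eqxx.
    by rewrite !rank_row ?ltn_predL ?(ltnW ck) ?(ltnW (ltnW ck)).
  - move=> c ck; rewrite row_letter_label prednK // eqxx.
    by rewrite rank_row ?ltn_predL ?ltnNge ?rank_max // -ck.
  - by rewrite /= ltnn inordK.
have oddy : OddCycles n 2 y.
  (* The class is the row [c] in which the vertex occupies a slot of [Y c], unique by [away]; all
     other vertices share the class [k] of the tail. *)
  pose cls (u : nat) :=
    if [pick c : 'I_k | [exists s in Y c, (occ c s : nat) == u]] is Some c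
    then (c : nat) else k.
  have clsE c s : c < k -> s \in Y c -> cls (occ c s) = c.
    move=> ck sY; rewrite /cls; case: pickP => [c' /existsP[s' /andP[s'Y /eqP/ord_inj eq]]|/(_ (Ordinal ck))].
      case: (ltngtP c c') => // cc'.
        by case: (away c c' s s' cc' (ltnW (ltn_ord c')) sY).
      by case: (away c' c s' s cc' (ltnW ck) s'Y).
    by move/negbT/existsP; case; exists s; rewrite sY eqxx.
  have cls_f : cls f = k.
    rewrite /cls; case: pickP => // c /existsP[s /andP[sY /eqP/ord_inj eq]].
    by case: (away c k s (ord0, ord0) (ltn_ord c) (leqnn k) sY).
  have cls_row c e : c < k -> e < L -> cls (row_letter (occ c) (x c) e).1 = c.
    by move=> ck eL; rewrite clsE //; have [xY _ _] := rows c ck; apply: xY.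
  apply: (@odd_cycles_class _ cls).
  apply: (@rows_then_step _ (fun u v : Sigma n 2 => cls u.1 <= cls v.1 /\
      (if cls u.1 == cls v.1 then 1 else 2) = (u.2 : nat).+1)) => //.
  - move=> c e ck eL; rewrite !cls_row ?(ltnW eL) // eqxx row_letter_label.
    by rewrite (ltn_eqF eL).
  - move=> c ck; rewrite row_letter_label prednK // eqxx.
    by rewrite !cls_row ?ltn_predL ?(ltnW ck) // ltn_eqF.
  - move=> c ck; rewrite row_letter_label prednK // eqxx.
    by rewrite cls_row ?ltn_predL ?cls_f -?ck // ltn_eqF.
  - by rewrite /= leqnn eqxx inordK.
have [+ _] := sep w; have [_] := sep y.
by move=> /(_ oddy _ kL0) + /(_ evenw _ tk); rewrite runw runy.
Qed.

(** Two words go round all [n] nodes, one with priority 2 on the closing edge of each lap, the other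
    with priority 1 throughout. They share their first n - 1 letters, hence the state at time n -
    1. *)
Lemma separation_time n (Q : finType) (q0 : Q) (delta : Q -> Sigma n 2 -> Q) t :
  0 < n -> 0 < t -> separates q0 delta (EvenCycles n 2) (OddCycles n 2) t -> n <= t.
Proof.
move=> n0 t0 [qacc sep]; rewrite leqNgt; apply/negP => tn.
pose node i : 'I_n := Ordinal (ltn_pmod i n0).
pose w i : Sigma n 2 := (node i, inord (n %| i.+1)).
pose y i : Sigma n 2 := (node i, inord 0).
have evenw : EvenCycles n 2 w.
  apply: (@even_cycles_rank _ id) => i; rewrite /= modnS inordK ?ltnS ?leq_b1 //.
  by case: (n %| i.+1); rewrite ?ltn0 ?ltnSn.
have oddy : OddCycles n 2 y.
  by apply: (@odd_cycles_class _ (fun=> 0)) => i; rewrite /= inordK.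
have tn1 : t <= n.-1 by rewrite -ltnS prednK.
have eq_wy : run q0 delta w n.-1 = run q0 delta y n.-1.
  apply: eq_run => e en; rewrite /w /y gtnNdvd //.
  by rewrite -(prednK n0) ltnS.
have [/(_ evenw _ tn1) + _] := sep w; have [_] := sep y.
by move=> /(_ oddy _ (leq_trans t0 tn1)); rewrite eq_wy.
Qed.

(** Loops of priority 2 and 1 on a single node must reach different states. With |Q| >= 2, having
    few states forces n^5/t^4 to be large. *)
Lemma separator_two_states n (Q : finType) (q0 : Q) (delta : Q -> Sigma n 2 -> Q) t :
  0 < n -> 0 < t -> separates q0 delta (EvenCycles n 2) (OddCycles n 2) t -> 1 < #|Q|.
Proof.
move=> n0 t0 [qacc sep].
pose const l (i : nat) : Sigma n 2 := (Ordinal n0, inord l).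
have evenw : EvenCycles n 2 (const 1).
  by apply: (@even_cycles_rank _ (fun=> 0)) => i; rewrite /= inordK.
have oddy : OddCycles n 2 (const 0).
  by apply: (@odd_cycles_class _ (fun=> 0)) => i; rewrite /= inordK.
have [/(_ evenw _ (leqnn t)) accept _] := sep (const 1).
have [_ /(_ oddy _ (leqnn 1)) /eqP reject] := sep (const 0).
by apply/card_gt1P; exists (run q0 delta (const 0) 1), qacc.
Qed.

Theorem theorem2 :
  exists c : R, Rlt 0 c /\
    forall n t : nat, 0 < n -> 0 < t ->
    forall (Q : finType) (q0 : Q) (delta : Q -> Sigma n 2 -> Q),
      separates q0 delta (EvenCycles n 2) (OddCycles n 2) t ->
      Rle (exp (Rdiv (Rmult c (pow (INR n) 5)) (pow (INR t) 4))) (INR #|Q|).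
Proof.
(* 2^24 = 16^4 * 256: the first factor comes from P <= 16t/n, the second from the exponent n/(256
   P^4) allowed in [concentration_parameters]. *)
exists (Rinv (pow (IZR 2) 24)); split.
  by apply: Rinv_0_lt_compat; apply: pow_lt; exact: Rlt_0_2.
move=> n t n0 t0 Q q0 delta sep; apply: Rnot_lt_le => few_states.
have nt := separation_time n0 t0 sep.
have Q1 := separator_two_states n0 t0 sep.
have [p [b [D [tk vertices num]]]] := exp_bound_parameters n0 nt Q1 few_states.
exact: (fooled_separator (ltn0Sn p) t0 tk vertices num sep).
Qed.
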